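(* The vector $$x=A^{(1)}c$$ is the general solution of the system $Ax=c$ if and only if the $\{1\}$-inverse $A^{(1)}$ of the system matrix $A$ has the form $$A^{(1)}=P\left[\begin{array}{c|c} I_a & U\\ \hline V & W\end{array}\right]Q$$ for arbitrary matrices $U$ and $W$ and the rows of the matrix $Vc'_a$ are free parameters, where $Qc=c'=\left[\begin{array}{c} c'_a\\ \hline 0\end{array}\right]$.
   Context: $Ax=c$ is a non-homogeneous linear system in $n$ variables, where $A\in\mathbb{C}^{m\times n}$ has rank $a$ and $c\in\mathbb{C}^{m\times 1}$. A $\{1\}$-inverse of $A$, denoted $A^{(1)}$, is any matrix $X$ satisfying $AXA=A$. The matrices $P\in\mathbb{C}^{n\times n}$ and $Q\in\mathbb{C}^{m\times m}$ are regular (invertible) and satisfy $QAP=E_a=\left[\begin{array}{c|c} I_a & 0\\ \hline 0 & 0\end{array}\right]$, with $I_a$ the $a\times a$ identity matrix. Every $\{1\}$-inverse of $A$ can be represented in Rohde's form $P\left[\begin{array}{c|c} I_a & U\\ \hline V & W\end{array}\right]Q$, where $U$, $V$, $W$ are arbitrary matrices of dimensions $a\times(m-a)$, $(n-a)\times a$, $(n-a)\times(m-a)$, respectively, with mutually independent entries. The block $c'_a$ consists of the first $a$ coordinates of $c'$. *)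

(* Defs.v *)
From mathcomp Require Import all_boot all_order all_algebra.
From mathcomp Require Import reals.
From mathcomp Require Export complex.

Set Implicit Arguments.
Unset Strict Implicit.
Unset Printing Implicit Defensive.

Import GRing.Theory.
Local Open Scope ring_scope.

Definition inverse1 (F : fieldType) (m n : nat) (A : 'M[F]_(m, n))
    (X : 'M[F]_(n, m)) : Prop :=
  A *m X *m A = A.

(* The casts only identify the block dimensions a + (n - a) and a + (m - a)
   with n and m. *)
Definition rohde_block (F : fieldType) (m n a : nat) (am : (a <= m)%N)
    (an : (a <= n)%N) (U : 'M[F]_(a, m - a)) (V : 'M[F]_(n - a, a))
    (W : 'M[F]_(n - a, m - a)) : 'M[F]_(n, m) :=
  castmx (subnKC an, subnKC am) (block_mx 1%:M U V W).

Definition col_block (F : fieldType) (m a : nat) (am : (a <= m)%N)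
    (u : 'cV[F]_a) (v : 'cV[F]_(m - a)) : 'cV[F]_m :=
  castmx (subnKC am, erefl 1%N) (col_mx u v).

(* A parametric expression x depending on parameters t : T is the general
   solution when it yields solutions only, and yields all of them. *)
Definition general_solution (F : fieldType) (m n : nat) (A : 'M[F]_(m, n))
    (c : 'cV[F]_m) (T : Type) (x : T -> 'cV[F]_n) : Prop :=
  (forall t, A *m x t = c) /\ (forall y, A *m y = c -> exists t, x t = y).

(* The rows of the column z t are free parameters when they can be assigned
   arbitrary scalar values, independently of one another. *)
Definition rows_free (F : fieldType) (k : nat) (T : Type)
    (z : T -> 'cV[F]_k) : Prop :=
  forall w : 'I_k -> F, exists t, forall i, z t i 0 = w i.

(* Main.v *)
Require Import Defs.
From mathcomp Require Import all_boot all_order all_algebra.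
From mathcomp Require Import reals complex.

Set Implicit Arguments.
Unset Strict Implicit.
Unset Printing Implicit Defensive.

Import GRing.Theory.
Local Open Scope ring_scope.

(** The change of unknown [y = P z] and the multiplication by [Q] on the left
    turn the system [A y = c] into [E z = Q c] with [E = pid_mx a], that is,
    into the condition that the upper part of [z] is [ca], while its lower
    part is arbitrary ([solution_pidE]).
    In the same coordinates a {1}-inverse [X] of [A] becomes a {1}-inverse of
    [E] ([inverse1_equiv]), and [E Y E] keeps only the upper left block of
    [Y]: so [Y] is a {1}-inverse of [E] exactly when that block is the
    identity, which gives Rohde's form ([rohde_form]).
    For [X] in this form [X c = P (ca; V ca)] ([rohde_mul_col]). Hence [X c]
    is always a solution, and, as [V] varies, [X c] runs through all the
    solutions exactly when [V ca] runs through all columns, that is, when its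
    rows are free parameters.

    The intermediate lemmas are about sizes [a + q] and [a + r], where blocks
    need no casts; sizes [m] and [n] equal to these sums are restored
    in [general_solution_rohde] by eliminating the two equations. *)

Section Field.

Variable F : fieldType.

Lemma inverse1_equiv m n (A : 'M[F]_(m, n)) (P : 'M_n) (Q : 'M_m)
    (X : 'M_(n, m)) :
  P \in unitmx -> Q \in unitmx ->
  inverse1 A X -> inverse1 (Q *m A *m P) (invmx P *m X *m invmx Q).
Proof.
move=> uP uQ AXA; rewrite /inverse1 !mulmxA mulmxK // mulmxKV //.
by rewrite -!(mulmxA Q) AXA.
Qed.

Section Blocks.

Variables a q r : nat.

Local Notation E := (pid_mx a : 'M[F]_(a + q, a + r)).

Lemma inverse1_pid_ulsub (Y : 'M[F]_(a + r, a + q)) :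
  inverse1 E Y -> ulsubmx Y = 1%:M.
Proof.
rewrite /inverse1 pid_mx_block -[Y]submxK !mulmx_block.
rewrite !(mul0mx, mulmx0, mul1mx, mulmx1, addr0).
by case/eq_block_mx=> ->; rewrite block_mxKul.
Qed.

Variables (A : 'M[F]_(a + q, a + r)) (P : 'M[F]_(a + r)) (Q : 'M[F]_(a + q)).
Hypotheses (uP : P \in unitmx) (uQ : Q \in unitmx) (QAP : Q *m A *m P = E).

Lemma rohde_form (X : 'M[F]_(a + r, a + q)) (Y := invmx P *m X *m invmx Q) :
  inverse1 A X ->
  X = P *m block_mx 1%:M (ursubmx Y) (dlsubmx Y) (drsubmx Y) *m Q.
Proof.
move=> /(inverse1_equiv uP uQ); rewrite QAP => /inverse1_pid_ulsub <-.
by rewrite submxK !mulmxA mulmxV // mul1mx mulmxKV.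
Qed.

Variables (c : 'cV[F]_(a + q)) (ca : 'cV[F]_a).
Hypothesis Qc : Q *m c = col_mx ca 0.

(** Multiplying by the invertible [Q] loses no equation, and the last [q]
    equations of the reduced system are [0 = 0]. *)
Lemma solution_pidE (z : 'cV[F]_(a + r)) :
  A *m (P *m z) = c <-> usubmx z = ca.
Proof.
have Ez : Q *m (A *m (P *m z)) = col_mx (usubmx z) 0.
  rewrite !mulmxA QAP pid_mx_block -{1}[z]vsubmxK mul_block_col.
  by rewrite !mul0mx mul1mx !addr0.
split=> [Az | zca]; first by move: Ez; rewrite Az Qc => /eq_col_mx[].
by apply: (can_inj (mulKmx uQ)); rewrite Ez Qc zca.
Qed.

Lemma rohde_mul_col (U : 'M[F]_(a, q)) (V : 'M[F]_(r, a)) (W : 'M[F]_(r, q)) :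
  P *m block_mx 1%:M U V W *m Q *m c = P *m col_mx ca (V *m ca).
Proof.
by rewrite -!mulmxA Qc mul_block_col !mulmx0 mul1mx !addr0.
Qed.

Lemma general_solution_blocks (T : Type) (X : T -> 'M[F]_(a + r, a + q))
    (U : T -> 'M[F]_(a, q)) (V : T -> 'M[F]_(r, a)) (W : T -> 'M[F]_(r, q)) :
  (forall t, X t = P *m block_mx 1%:M (U t) (V t) (W t) *m Q) ->
  general_solution A c (fun t => X t *m c) <-> rows_free (fun t => V t *m ca).
Proof.
move=> XE.
have Xc t : X t *m c = P *m col_mx ca (V t *m ca).
  by rewrite XE rohde_mul_col.
split=> [[_ all_sol] w | free].
  (* The values w of the parameters are read off the solution P (ca; w). *)
  have [|t] := all_sol (P *m col_mx ca (\col_i w i)).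
    by apply/solution_pidE; rewrite col_mxKu.
  rewrite Xc => /(can_inj (mulKmx uP))/eq_col_mx[_ Vw].
  by exists t => i; rewrite Vw mxE.
split=> [t | y Ay]; first by rewrite Xc; apply/solution_pidE; rewrite col_mxKu.
have [z yE] : exists z, y = P *m z by exists (invmx P *m y); rewrite mulKVmx.
move: Ay; rewrite yE => /solution_pidE zca.
have [t Vt] := free (fun i => dsubmx z i 0).
exists t; rewrite Xc -[z in RHS]vsubmxK zca; congr (P *m col_mx _ _).
by apply/colP.
Qed.

End Blocks.

(** The sizes [m] and [n] are variables tied to [a + q] and [a + r] by
    equations, so that eliminating these removes all casts. This could not be
    done directly with [a] the rank of [A], as [a] would then depend on [A]
    and hence on [m] and [n]. *)
Lemma general_solution_rohde (m n a q r : nat) (em : (a + q)%N = m)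
    (en : (a + r)%N = n) (A : 'M[F]_(m, n)) (c : 'cV[F]_m) (P : 'M[F]_n)
    (Q : 'M[F]_m) (ca : 'cV[F]_a) (T : Type) (A1 : T -> 'M[F]_(n, m)) :
  P \in unitmx -> Q \in unitmx -> Q *m A *m P = pid_mx a ->
  Q *m c = castmx (em, erefl 1%N) (col_mx ca 0) ->
  (forall t, inverse1 A (A1 t)) ->
  general_solution A c (fun t => A1 t *m c) <->
  exists (U : T -> 'M[F]_(a, q)) (V : T -> 'M[F]_(r, a))
         (W : T -> 'M[F]_(r, q)),
    (forall t, A1 t = P *m castmx (en, em) (block_mx 1%:M (U t) (V t) (W t))
                        *m Q)
    /\ rows_free (fun t => V t *m ca).
Proof.
case: _ / em A c Q A1 => A c Q A1; case: _ / en A P A1 => A P A1.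
move=> uP uQ QAP; rewrite castmx_id => Qc invA1.
split=> [gen | [U [V [W [A1E free]]]]].
  pose Y t := invmx P *m A1 t *m invmx Q.
  have A1E t := rohde_form uP uQ QAP (invA1 t).
  exists (fun t => ursubmx (Y t)), (fun t => dlsubmx (Y t)).
  exists (fun t => drsubmx (Y t)).
  split=> [t|]; first by rewrite castmx_id -A1E.
  exact/(general_solution_blocks uP uQ QAP Qc A1E).
have {}A1E t : A1 t = P *m block_mx 1%:M (U t) (V t) (W t) *m Q.
  by rewrite A1E castmx_id.
exact/(general_solution_blocks uP uQ QAP Qc A1E).
Qed.

End Field.

Theorem corollary2p5 (R : realType) (m n : nat)
    (A : 'M[R[i]]_(m, n)) (c : 'cV[R[i]]_m)
    (P : 'M[R[i]]_n) (Q : 'M[R[i]]_m) (ca : 'cV[R[i]]_(\rank A))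
    (T : Type) (A1 : T -> 'M[R[i]]_(n, m)) :
  c != 0 ->
  P \in unitmx ->
  Q \in unitmx ->
  Q *m A *m P = pid_mx (\rank A) ->
  Q *m c = col_block (rank_leq_row A) ca 0 ->
  (forall t, inverse1 A (A1 t)) ->
  general_solution A c (fun t => A1 t *m c) <->
  exists (U : T -> 'M[R[i]]_(\rank A, m - \rank A))
         (V : T -> 'M[R[i]]_(n - \rank A, \rank A))
         (W : T -> 'M[R[i]]_(n - \rank A, m - \rank A)),
    (forall t, A1 t = P *m rohde_block (rank_leq_row A) (rank_leq_col A)
                             (U t) (V t) (W t) *m Q)
    /\ rows_free (fun t => V t *m ca).
Proof. by move=> _; exact: general_solution_rohde. Qed.
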